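(* Let a price function $P:\mathbb{R}_{\ge 0}\to\mathbb{R}_{\ge 0}$ be given. All distance tariffs with respect to $P$ (on all PTNs) satisfy the no-stopover property if and only if $P$ is subadditive on $\mathbb{R}_{>0}$, i.e. $P(a+b)\le P(a)+P(b)$ for all $a,b\in\mathbb{R}_{>0}$.
   Context: A PTN is a finite, simple, connected, undirected graph $(V,E)$, here with a positive physical length assigned to each edge. A path is a finite sequence $(x_1,\dots,x_n)$, $n\ge 1$, of (not necessarily distinct) nodes with consecutive nodes adjacent; $\mathcal{W}$ is the set of all paths; $l(W)$ is the sum of the edge lengths along $W$; $[x_i,x_j]$ denotes the subpath $(x_i,\dots,x_j)$. A fare structure is a function $p:\mathcal{W}\to\mathbb{R}_{\ge 0}$. It is a distance tariff with respect to $P$ if $p(W)=P(l(W))$ for all $W\in\mathcal{W}$. No-stopover property: $p([x_1,x_n])\le p([x_1,x_i])+p([x_i,x_n])$ for all paths $(x_1,\dots,x_n)\in\mathcal{W}$, $n\ge 3$, and all $i\in\{2,\dots,n-1\}$. *)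

(* Defs.v *)
From HB Require Import structures.
From mathcomp Require Import all_boot all_order all_algebra.
From mathcomp Require Import interval_inference.
From mathcomp Require Import reals.

Set Implicit Arguments.
Unset Strict Implicit.
Unset Printing Implicit Defensive.

Import Order.TTheory GRing.Theory Num.Theory.
Local Open Scope ring_scope.

Definition adjacent (V : finType) (E : {set {set V}}) : rel V :=
  fun x y => [set x; y] \in E.

(* Edges are two-element sets of nodes, so the graph is simple and undirected.
   The values of [edge_length] outside [edges] are irrelevant. *)
Record ptn (R : realType) := Ptn {
  node : finType;
  edges : {set {set node}};
  edge_length : {set node} -> R;
  edges_card2 : forall e, e \in edges -> #|e| = 2%N;
  ptn_connected : forall x y, connect (adjacent edges) x y;
  edge_length_gt0 : forall e, e \in edges -> 0 < edge_length e }.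

(* Nodes may be repeated, so this is a walk in the graph-theoretic sense. *)
Record ptn_path (R : realType) (N : ptn R) := PtnPath {
  nodes :> seq (node N);
  nodes_path : (0 < size nodes)%N && sorted (adjacent (edges N)) nodes }.

HB.instance Definition _ (R : realType) (N : ptn R) :=
  [isSub for @nodes R N].

Definition nodes_length (R : realType) (N : ptn R) (s : seq (node N)) : R :=
  \sum_(e <- zip s (behead s)) edge_length [set e.1; e.2].

Lemma nodes_length_ge0 (R : realType) (N : ptn R) (W : ptn_path N) :
  0 <= nodes_length W.
Proof.
rewrite /nodes_length; case: W => -[//|x s] /= xs.
elim: s x xs => [|y s IHs] x /=; first by rewrite big_nil.
case/andP=> xy ys; rewrite big_cons /= addr_ge0 ?IHs //.
exact/ltW/edge_length_gt0.
Qed.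

Definition path_length (R : realType) (N : ptn R) (W : ptn_path N) :
  {nonneg R} := NngNum (nodes_length_ge0 W).

(* [subpath W i j] is [x_i, x_j] for W = (x_1, ..., x_n), with indices starting
   at 1.  It has the junk value W unless 1 <= i <= j <= n; see [subpathE]. *)
Definition subpath (R : realType) (N : ptn R) (W : ptn_path N) (i j : nat) :
  ptn_path N := insubd W (take (j - i.-1) (drop i.-1 W)).

Lemma subpathE (R : realType) (N : ptn R) (W : ptn_path N) (i j : nat) :
  (0 < i)%N -> (i <= j)%N -> (j <= size W)%N ->
  subpath W i j = take (j - i.-1) (drop i.-1 W) :> seq (node N).
Proof.
move=> i_gt0 le_ij le_jW; rewrite /subpath -[LHS]/(val _) val_insubd.
have lt_ij : (i.-1 < j)%N by rewrite prednK.
have sW : sorted (adjacent (edges N)) (take (j - i.-1) (drop i.-1 W)).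
  by apply/take_sorted/drop_sorted; case/andP: (nodes_path W).
by rewrite sW size_take_min size_drop leq_min !subn_gt0 lt_ij (leq_trans lt_ij).
Qed.

Definition fare_structure (R : realType) (N : ptn R) :=
  ptn_path N -> {nonneg R}.

Definition price_function (R : realType) := {nonneg R} -> {nonneg R}.

Definition distance_tariff (R : realType) (N : ptn R) (P : price_function R)
    (p : fare_structure N) : Prop :=
  forall W : ptn_path N, p W = P (path_length W).

Definition no_stopover (R : realType) (N : ptn R) (p : fare_structure N) :
    Prop :=
  forall W : ptn_path N, (3 <= size W)%N ->
  forall i : nat, (2 <= i <= (size W).-1)%N ->
    (p (subpath W 1 (size W)))%:num <=
    (p (subpath W 1 i))%:num + (p (subpath W i (size W)))%:num.

Definition subadditive_on_pos (R : realType) (P : price_function R) : Prop :=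
  forall a b : {posnum R},
    (P (a%:num + b%:num)%:nng)%:num <=
    (P a%:num%:nng)%:num + (P b%:num%:nng)%:num.

(* Main.v *)
Require Import Defs.
From mathcomp Require Import all_boot all_order all_algebra.
From mathcomp Require Import interval_inference.
From mathcomp Require Import reals.

(** A path broken at an intermediate node splits its length into the lengths
    of the two pieces ([path_length_split]), and each piece has positive length
    because it contains at least one edge ([nodes_length_gt0]).  For a distance
    tariff the no-stopover inequality is therefore an instance of
    [P (a + b) <= P a + P b] with [a, b > 0].  Conversely every pair
    [a, b > 0] arises in this way: in a network made of two edges of lengths
    [a] and [b] sharing a node, consider the path that runs through both. *)

Set Implicit Arguments.
Unset Strict Implicit.
Unset Printing Implicit Defensive.

Import Order.TTheory GRing.Theory Num.Theory.
Local Open Scope ring_scope.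

Section PathLength.

Variables (R : realType) (N : ptn R).
Implicit Types (s : seq (node N)) (W : ptn_path N).

Lemma nodes_length1 (x : node N) : nodes_length [:: x] = 0.
Proof. by rewrite /nodes_length big_nil. Qed.

Lemma nodes_length_cons2 (x y : node N) s :
  nodes_length [:: x, y & s] =
  edge_length [set x; y] + nodes_length (y :: s).
Proof. by rewrite /nodes_length /= big_cons. Qed.

(** The node at index [k] belongs to both pieces, hence the shift between
    [take] and [drop]: the edges, not the nodes, are distributed. *)
Lemma nodes_length_split k s : (k < size s)%N ->
  nodes_length s = nodes_length (take k.+1 s) + nodes_length (drop k s).
Proof.
elim: s k => [//|x s IHs] [|k] /=; first by rewrite take0 nodes_length1 add0r.
case: s IHs => [//|y s] IHs lt_ks.
by rewrite !nodes_length_cons2 (IHs k lt_ks) addrA.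
Qed.

(** Strictness matters: the price function is only subadditive at positive
    arguments, so no piece of a broken path may have length zero. *)
Lemma nodes_length_gt0 W : (1 < size W)%N -> 0 < nodes_length W.
Proof.
case: W => -[//|x [//|y s]] /= xys _.
have [xy ys] := andP xys; rewrite nodes_length_cons2.
apply: ltr_wpDr; first exact: (nodes_length_ge0 (@PtnPath _ N (y :: s) ys)).
exact: edge_length_gt0.
Qed.

Lemma subpath_full W : subpath W 1 (size W) = W.
Proof.
have W_gt0 : (0 < size W)%N by case/andP: (nodes_path W).
by apply: val_inj; rewrite /= subpathE // subn0 drop0 take_size.
Qed.

Lemma size_subpath W i j : (0 < i)%N -> (i <= j)%N -> (j <= size W)%N ->
  size (subpath W i j) = (j - i.-1)%N.
Proof.
move=> i_gt0 le_ij le_jW; rewrite subpathE // size_takel //.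
by rewrite size_drop leq_sub2r.
Qed.

Lemma path_length_split W i : (1 <= i <= size W)%N ->
  nodes_length W =
  nodes_length (subpath W 1 i) + nodes_length (subpath W i (size W)).
Proof.
case: i => // i /andP[_ lt_iW].
rewrite !subpathE // subn0 drop0 (nodes_length_split lt_iW).
by rewrite [take (_ - _) _]take_oversize ?size_drop.
Qed.

End PathLength.

Section TwoEdges.

Variables (R : realType) (a b : {posnum R}).

(** The two-edge network is encoded as a star: the centre is [None], and the
    leaves [Some true] and [Some false] will lie at distances [a] and [b] from
    it, so that an edge is determined by the leaf it contains. *)
Definition spoke (c : bool) : {set option bool} := [set Some c; None].

Definition spokes : {set {set option bool}} := [set spoke c | c : bool].

Definition spoke_length (e : {set option bool}) : R :=
  if Some true \in e then a%:num else b%:num.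

Lemma spokes_card2 e : e \in spokes -> #|e| = 2%N.
Proof. by case/imsetP=> c _ ->; rewrite cards2. Qed.

Lemma adjacent_spoke c : adjacent spokes (Some c) None.
Proof. exact: imset_f. Qed.

Lemma adjacent_spokes_sym : symmetric (adjacent spokes).
Proof. by move=> x y; rewrite /adjacent setUC. Qed.

Lemma spokes_connected x y : connect (adjacent spokes) x y.
Proof.
have to_centre z : connect (adjacent spokes) z None.
  by case: z => [c|]; [exact: connect1 (adjacent_spoke c) | exact: connect0].
apply: connect_trans (to_centre x) _.
by rewrite (sym_connect_sym adjacent_spokes_sym).
Qed.

Lemma spoke_length_gt0 e : e \in spokes -> 0 < spoke_length e.
Proof. by rewrite /spoke_length; case: ifP. Qed.

Definition two_edge_ptn : ptn R :=
  Ptn spokes_card2 spokes_connected spoke_length_gt0.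

Definition through_nodes : seq (node two_edge_ptn) :=
  [:: Some true; None; Some false].

Lemma through_nodes_path :
  (0 < size through_nodes)%N &&
  sorted (adjacent (edges two_edge_ptn)) through_nodes.
Proof.
by rewrite /= adjacent_spoke adjacent_spokes_sym adjacent_spoke.
Qed.

Definition through_path : ptn_path two_edge_ptn := PtnPath through_nodes_path.

Lemma length_first_spoke :
  nodes_length (subpath through_path 1 2) = a%:num.
Proof.
rewrite subpathE //= nodes_length_cons2 nodes_length1 addr0 /=.
by rewrite /spoke_length !inE.
Qed.

Lemma length_second_spoke :
  nodes_length (subpath through_path 2 3) = b%:num.
Proof.
rewrite subpathE //= nodes_length_cons2 nodes_length1 addr0 /=.
by rewrite /spoke_length !inE.
Qed.

End TwoEdges.

Theorem theorem9 (R : realType) (P : price_function R) :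
  (forall (N : ptn R) (p : fare_structure N),
      distance_tariff P p -> no_stopover p) <->
  subadditive_on_pos P.
Proof.
split=> [no_stop a b | subP N p pP W W_ge3 i /andP[i_ge2 le_iW]].
  pose W := through_path a b.
  have tariff : distance_tariff P (fun W' : ptn_path (two_edge_ptn a b) =>
    P (path_length W')) by [].
  have := no_stop _ _ tariff W isT 2%N isT.
  rewrite subpath_full.
  have -> : path_length W = (a%:num + b%:num)%:nng.
    apply: val_inj; rewrite /= (@path_length_split _ _ W 2) //.
    by rewrite length_first_spoke length_second_spoke.
  have -> : path_length (subpath W 1 2) = a%:num%:nng.
    by apply: val_inj; exact: length_first_spoke.
  have -> // : path_length (subpath W 2 (size W)) = b%:num%:nng.
  by apply: val_inj; exact: length_second_spoke.
have i_gt0 : (0 < i)%N by apply: ltnW.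
have lt_iW : (i < size W)%N by rewrite -(ltn_predK W_ge3) ltnS.
have l1_gt0 : 0 < nodes_length (subpath W 1 i).
  by rewrite nodes_length_gt0 // size_subpath ?subn0 // ltnW.
have l2_gt0 : 0 < nodes_length (subpath W i (size W)).
  rewrite nodes_length_gt0 // size_subpath ?(ltnW lt_iW) //.
  by rewrite ltn_subRL addn1 prednK.
rewrite subpath_full !pP.
have := subP (PosNum l1_gt0) (PosNum l2_gt0).
have -> : ((PosNum l1_gt0)%:num + (PosNum l2_gt0)%:num)%:nng = path_length W.
  by apply: val_inj; rewrite /= -path_length_split // i_gt0 ltnW.
have -> : (PosNum l1_gt0)%:num%:nng = path_length (subpath W 1 i).
  exact: val_inj.
have -> // : (PosNum l2_gt0)%:num%:nng = path_length (subpath W i (size W)).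
exact: val_inj.
Qed.
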